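(* Let $B$ be a quasi-category. The canonical 2-cell $\kappa\colon\mathrm{res}\Rightarrow c\cdot\mathrm{ev}_0$ in $\mathrm{qCat}_2$, where $\mathrm{ev}_0\colon B^{\Delta_\infty}\to B$ is evaluation at $[0]$, $\mathrm{res}\colon B^{\Delta_\infty}\to B^{\Delta^{op}}$ is restriction along $\Delta^{op}\hookrightarrow\Delta_\infty$ and $c\colon B\to B^{\Delta^{op}}$ is the constant diagram functor, displays $\mathrm{ev}_0$ as an absolute left lifting of $\mathrm{res}$ through $c$. Hence, given any simplicial object $\Delta^{op}\to B$ admitting an augmentation and a splitting, i.e. an extension to $D\colon\Delta_\infty\to B$, the augmented simplicial object (the restriction of $D$ to $\Delta_+^{op}$) defines a colimit cone over the original simplicial object, with colimit $D([0])$. Furthermore, such colimits are preserved by any functor: for every functor $k\colon B\to A$ of quasi-categories, the whiskered 2-cell $k^{\Delta^{op}}\kappa\colon k^{\Delta^{op}}\mathrm{res}\Rightarrow k^{\Delta^{op}}c\,\mathrm{ev}_0=c\,k\,\mathrm{ev}_0$ displays $k\,\mathrm{ev}_0$ as an absolute left lifting of $k^{\Delta^{op}}\mathrm{res}$ through $c\colon A\to A^{\Delta^{op}}$.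
   Context: A quasi-category is a simplicial set with fillers for all inner horns; functors are simplicial maps between quasi-categories; categories are identified with their nerves. $B^X$ is the internal hom of simplicial sets. $\mathrm{qCat}_2$ is the strict 2-category of quasi-categories with hom-categories $\hom'(A,B)=h(B^A)$, where $h\colon\mathrm{sSet}\to\mathrm{Cat}$ is left adjoint to the nerve. A 2-cell $\lambda\colon g\Rightarrow f\ell$ (with $f\colon B\to A$, $g\colon C\to A$, $\ell\colon C\to B$) displays $\ell$ as an absolute left lifting of $g$ through $f$ if for all $b\colon X\to B$, $x\colon X\to C$ and every 2-cell $\chi\colon gx\Rightarrow fb$ there is a unique 2-cell $\zeta\colon\ell x\Rightarrow b$ with $\chi=f\zeta\cdot\lambda x$. A colimit cone over a diagram $d\colon X\to B$ is a 2-cell $\lambda\colon d\Rightarrow c\ell$ displaying a vertex $\ell\colon\Delta^0\to B$ as an absolute left lifting of $d\colon\Delta^0\to B^X$ through the constant diagram functor $c\colon B\to B^X$. $\Delta_+$ is the category of finite ordinals $[n]=\{0<\dots<n\}$, $n\ge-1$, and order-preserving maps; $\Delta$ is its full subcategory of non-empty ordinals. $\Delta_\infty\subset\Delta$ is the subcategory of all objects and those maps preserving top elements. The inclusion $\Delta_+^{op}\hookrightarrow\Delta_\infty$ sends $[n]$ to $[n+1]$ and $\alpha\colon[m]\to[n]$ to the map $[n+1]\to[m+1]$, $j\mapsto\#\{i\in[m]:\alpha(i)<j\}$; it sends $[-1]$ to $[0]$, and it restricts to $\Delta^{op}\hookrightarrow\Delta_\infty$. Since $[0]$ is terminal in $\Delta_\infty$,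 there is a unique natural transformation from $\Delta^{op}\hookrightarrow\Delta_\infty$ to the constant functor at $[0]$; applying the 2-functor $B^{(-)}$ to it gives the canonical 2-cell $\kappa\colon\mathrm{res}\Rightarrow c\cdot\mathrm{ev}_0$. A simplicial object $\Delta^{op}\to B$ is augmented if it is extended to $\Delta_+^{op}$ and split if it is further extended to $\Delta_\infty$; the augmentation is the value at $[0]\in\Delta_\infty$. *)

(* Defs.v *)
From HB Require Import structures.
#[warnings="-notation-overridden"]
From mathcomp Require Import all_boot generic_quotient.
(* boolp provides the extensionality that makes Leibniz equality the right
   notion of equality for maps, functors and classes of edge-paths. *)
From mathcomp Require Import boolp.

Set Implicit Arguments.
Unset Strict Implicit.
Unset Printing Implicit Defensive.

Declare Scope qcat_scope.
Delimit Scope qcat_scope with qcat.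
Local Open Scope quotient_scope.

Record category := Category {
  obj :> Type;
  hom : obj -> obj -> Type;
  idm : forall x, hom x x;
  cmp : forall x y z, hom y z -> hom x y -> hom x z;
  cmp1m : forall x y (f : hom x y), cmp (idm y) f = f;
  cmpm1 : forall x y (f : hom x y), cmp f (idm x) = f;
  cmpA : forall x y z t (h : hom z t) (g : hom y z) (f : hom x y),
    cmp h (cmp g f) = cmp (cmp h g) f }.
Arguments idm {c} x.

Record functor (C D : category) := Functor {
  fobj :> C -> D;
  fmap : forall x y, hom x y -> hom (fobj x) (fobj y);
  fmap_id : forall x, fmap (idm x) = idm (fobj x);
  fmap_cmp : forall x y z (g : hom y z) (f : hom x y),
    fmap (cmp g f) = cmp (fmap g) (fmap f) }.
Arguments fmap {C D} _ {x y} _.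

Record nattrans (C D : category) (F G : functor C D) := Nattrans {
  ntc :> forall x, hom (F x) (G x);
  nt_nat : forall x y (f : hom x y),
    cmp (ntc y) (fmap F f) = cmp (fmap G f) (ntc x) }.

Definition opcat (C : category) : category :=
  @Category C (fun x y => hom y x) (@idm C) (fun x y z g f => cmp f g)
    (fun _ _ f => cmpm1 f) (fun _ _ f => cmp1m f)
    (fun _ _ _ _ h g f => esym (cmpA f g h)).

Definition compf (C D E : category) (G : functor D E) (F : functor C D) :
  functor C E.
Proof.
refine (@Functor C E (G \o F) (fun x y f => fmap G (fmap F f)) _ _).
- by move=> x; rewrite /= !fmap_id.
- by move=> x y z g f; rewrite !fmap_cmp.
Defined.

Definition constf (C D : category) (t : D) : functor C D.
Proof.
refine (@Functor C D (fun _ => t) (fun _ _ _ => idm t) _ _) => //.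
by move=> *; rewrite cmp1m.
Defined.

Record terminal (C : category) (t : C) := Terminal {
  bang : forall x, hom x t;
  bang_uniq : forall x (f : hom x t), f = bang x }.

Definition to_terminal (C D : category) (F : functor C D) (t : D)
  (ht : terminal t) : nattrans F (constf C t).
Proof.
refine (@Nattrans C D F (constf C t) (fun x => bang ht (F x)) _).
by move=> x y f; apply: etrans (bang_uniq ht _) (esym (bang_uniq ht _)).
Defined.

(* Order-preserving maps [m-1] -> [n-1], where [k-1] is 'I_k; so
   [ordhom m.+1 n.+1] is the set of maps [m] -> [n] of Delta. *)
Record ordhom (m n : nat) := Ordhom {
  ohf :> 'I_m -> 'I_n;
  ohP : {homo ohf : i j / (i <= j)%N} }.

Lemma ordhomP m n (f g : ordhom m n) : f =1 g -> f = g.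
Proof.
case: f g => [f fP] [g gP] /= /funext efg.
by case: _ / efg in gP *; congr Ordhom; apply: Prop_irrelevance.
Qed.

Definition ohid n : ordhom n n := @Ordhom n n id (fun _ _ => id).

Definition ohcomp m n p (g : ordhom n p) (f : ordhom m n) : ordhom m p :=
  @Ordhom m p (fun i => g (f i)) (fun _ _ h => ohP g (ohP f h)).

Definition ohcst m n (k : 'I_n) : ordhom m n :=
  @Ordhom m n (fun _ => k) (fun _ _ _ => leqnn k).

Definition coface n (k : 'I_n.+1) : ordhom n n.+1.
Proof. by refine (@Ordhom n n.+1 (lift k) _) => i j; rewrite /= leq_bump2. Defined.

(* The object n of [DeltaPlus] is the ordinal [n-1]. *)
Definition DeltaPlus : category.
Proof.
by refine (@Category nat ordhom ohid ohcomp _ _ _) => *; apply: ordhomP.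
Defined.

(* The object n of [Delta] is the ordinal [n]. *)
Definition Delta : category.
Proof.
refine (@Category nat (fun m n => ordhom m.+1 n.+1) (fun n => ohid n.+1)
  (fun m n p => @ohcomp m.+1 n.+1 p.+1) _ _ _) => *; exact: ordhomP.
Defined.

Definition tophom (m n : nat) :=
  {f : ordhom m.+1 n.+1 | f ord_max = ord_max}.

Lemma tophomP m n (f g : tophom m n) : sval f =1 sval g -> f = g.
Proof. by case: f g => [f fP] [g gP] /= /ordhomP efg; apply: eq_exist. Qed.

Definition tophom_id n : tophom n n := exist _ (ohid n.+1) erefl.

Definition tophom_comp m n p (g : tophom n p) (f : tophom m n) : tophom m p :=
  exist _ (ohcomp (sval g) (sval f))
    (etrans (congr1 (sval g) (svalP f)) (svalP g)).

(* The object n of [DeltaInf] is the ordinal [n]. *)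
Definition DeltaInf : category.
Proof.
by refine (@Category nat tophom tophom_id tophom_comp _ _ _) => *;
  apply: tophomP.
Defined.

Definition incl_Delta : functor (opcat Delta) (opcat DeltaPlus).
Proof.
by refine (@Functor (opcat Delta) (opcat DeltaPlus) succn (fun _ _ f => f) _ _).
Defined.

Lemma card_lt_subproof m n (a : ordhom m n) (j : 'I_n.+1) :
  (#|[pred i : 'I_m | a i < j]| < m.+1)%N.
Proof. by rewrite ltnS -[X in (_ <= X)%N]card_ord max_card. Qed.

Definition split_fun m n (a : ordhom m n) (j : 'I_n.+1) : 'I_m.+1 :=
  Ordinal (card_lt_subproof a j).

Lemma split_fun_homo m n (a : ordhom m n) :
  {homo split_fun a : i j / (i <= j)%N}.
Proof.
move=> i j ij /=; apply: subset_leq_card; apply/subsetP => k.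
by rewrite !inE => /leq_trans; apply.
Qed.

Lemma split_fun_top m n (a : ordhom m n) : split_fun a ord_max = ord_max.
Proof.
apply: val_inj => /=; rewrite -[RHS]card_ord; apply: eq_card => i.
by rewrite !inE ltn_ord.
Qed.

(* The map [n+1] -> [m+1], j |-> #{i | a i < j} associated with a : [m] -> [n]
   (the ordinals [m] and [n] being possibly empty, m and n are shifted). *)
Definition split_map m n (a : ordhom m n) : tophom n m :=
  exist _ (Ordhom (@split_fun_homo m n a)) (split_fun_top a).

Lemma card_ltn_ord n k : (k <= n)%N -> #|[pred i : 'I_n | (i < k)%N]| = k.
Proof.
move=> kn; rewrite -sum1_card (eq_bigl (fun i : 'I_n => (i < k)%N)) //.
by rewrite (big_ord_narrow kn) sum_nat_const card_ord muln1.
Qed.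

Lemma card_lt_ordhom n p (b : ordhom n p) (j : nat) (k : 'I_n) :
  (k < #|[pred i : 'I_n | b i < j]|)%N = (b k < j)%N.
Proof.
apply/idP/idP => h.
- case: (ltnP (b k) j) => // jk; move: h; rewrite ltnNge => /negP[].
  have -> : nat_of_ord k = #|[pred i : 'I_n | (i < k)%N]|.
    by apply: esym; apply: card_ltn_ord; rewrite ?ltn_ord // ltnW.
  apply: subset_leq_card; apply/subsetP => i; rewrite !inE => ij.
  by rewrite ltnNge; apply/negP => /(ohP b) /(leq_trans jk); rewrite leqNgt ij.
- have -> : (nat_of_ord k).+1 = #|[pred i : 'I_n | (i < k.+1)%N]|.
    by apply: esym; apply: card_ltn_ord; rewrite ?ltn_ord // ltnW.
  apply: subset_leq_card; apply/subsetP => i; rewrite !inE => ik.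
  by apply: leq_ltn_trans h; apply: (ohP b).
Qed.

Definition incl_split : functor (opcat DeltaPlus) DeltaInf.
Proof.
refine (@Functor (opcat DeltaPlus) DeltaInf id
  (fun n m (a : ordhom m n) => split_map a) _ _).
- move=> n; apply: tophomP => j; apply: val_inj => /=.
  by apply: card_ltn_ord; rewrite -ltnS.
- move=> p n m a b; apply: tophomP => j; apply: val_inj => /=.
  by apply: eq_card => i; rewrite !inE /= card_lt_ordhom.
Defined.

Definition incl_DeltaInf : functor (opcat Delta) DeltaInf :=
  compf incl_split incl_Delta.

Definition terminal_Delta0 : @terminal DeltaInf 0.
Proof.
refine (@Terminal DeltaInf 0
  (fun n => exist _ (ohcst n.+1 ord0) (esym (ord1 ord_max)) : tophom n 0) _).
by move=> n f; apply: tophomP => i; rewrite !ord1.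
Defined.

Definition terminal_empty : @terminal (opcat DeltaPlus) 0.
Proof.
refine (@Terminal (opcat DeltaPlus) 0
  (fun n => Ordhom (ohf := fun i : 'I_0 => widen_ord (leq0n n) i)
     (fun i j h => h)) _).
by move=> n f; apply: ordhomP => -[].
Defined.

Record sset := SSet {
  simp :> nat -> Type;
  act : forall m n, ordhom m.+1 n.+1 -> simp n -> simp m;
  act_id : forall n (x : simp n), act (ohid n.+1) x = x;
  act_comp : forall m n p (g : ordhom n.+1 p.+1) (f : ordhom m.+1 n.+1)
    (x : simp p), act (ohcomp g f) x = act f (act g x) }.
Arguments act {s m n} _ _.

Record smap (X Y : sset) := SMap {
  smf :> forall n, X n -> Y n;
  smap_act : forall m n (f : ordhom m.+1 n.+1) (x : X n),
    smf (act f x) = act f (smf x) }.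
Arguments smf {X Y} _ n _.

Lemma smapP (X Y : sset) (f g : smap X Y) : (forall n (x : X n), f n x = g n x) -> f = g.
Proof.
case: f g => [f fP] [g gP] /= efg.
have {}efg : f = g by apply: functional_extensionality_dep => n; apply: funext.
by case: _ / efg in gP *; congr SMap; apply: Prop_irrelevance.
Qed.

Definition comps (X Y Z : sset) (g : smap Y Z) (f : smap X Y) : smap X Z.
Proof.
by refine (@SMap X Z (fun n x => g n (f n x)) _) => *; rewrite !smap_act.
Defined.
Notation "g \os f" := (comps g f) (at level 50, left associativity) : qcat_scope.
Local Open Scope qcat_scope.

Definition stdsimplex (n : nat) : sset.
Proof.
by refine (@SSet (fun m => ordhom m.+1 n.+1) (fun m p f a => ohcomp a f) _ _) => *;
  apply: ordhomP.
Defined.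

Definition sprod (X Y : sset) : sset.
Proof.
refine (@SSet (fun n => (X n * Y n)%type)
  (fun m n f p => (act f p.1, act f p.2)) _ _).
- by move=> n [x y]; rewrite !act_id.
- by move=> *; rewrite !act_comp.
Defined.

Definition horn_simp n (k : 'I_n.+1) (m : nat) :=
  {a : ordhom m.+1 n.+1 | exists2 j : 'I_n.+1, j != k & forall i, a i != j}.

Lemma horn_subproof n (k : 'I_n.+1) m p (f : ordhom m.+1 p.+1)
  (a : horn_simp k p) :
  exists2 j : 'I_n.+1, j != k & forall i, ohcomp (sval a) f i != j.
Proof. by case: a => a [j jk aj]; exists j => // i; apply: aj. Qed.

Definition horn (n : nat) (k : 'I_n.+1) : sset.
Proof.
refine (@SSet (horn_simp k)
  (fun m p f a => exist _ (ohcomp (sval a) f) (horn_subproof f a)) _ _).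
- by move=> p [a aP]; apply: eq_exist; apply: ordhomP.
- by move=> m p q g f [a aP]; apply: eq_exist; apply: ordhomP.
Defined.

Definition quasi_category (X : sset) : Prop :=
  forall (n : nat) (k : 'I_n.+1), (0 < k < n)%N ->
  forall u : smap (horn k) X, exists v : smap (stdsimplex n) X,
  forall m (a : horn k m), v m (sval a) = u m a.

Definition ihom_act (X B : sset) m n (f : ordhom m.+1 n.+1)
  (u : smap (sprod (stdsimplex n) X) B) : smap (sprod (stdsimplex m) X) B.
Proof.
refine (@SMap (sprod (stdsimplex m) X) B
  (fun p sx => u p (ohcomp f sx.1, sx.2)) _).
by move=> p q g [s x]; rewrite -smap_act.
Defined.

Definition ihom (X B : sset) : sset.
Proof.
refine (@SSet (fun n => smap (sprod (stdsimplex n) X) B) (@ihom_act X B) _ _).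
- by move=> n u; apply: smapP => p [s x]; congr (u _ (_, _)); apply: ordhomP.
- by move=> m n q g f u; apply: smapP => p [s x]; congr (u _ (_, _));
    apply: ordhomP.
Defined.

Definition ordcat (n : nat) : category.
Proof.
by refine (@Category 'I_n.+1 (fun i j => (i <= j)%N) (fun i => leqnn i)
  (fun i j k hjk hij => leq_trans hij hjk) _ _ _) => *; apply: bool_irrelevance.
Defined.

Definition ordfun m n (f : ordhom m.+1 n.+1) : functor (ordcat m) (ordcat n).
Proof.
by refine (@Functor (ordcat m) (ordcat n) f (fun i j h => ohP f h) _ _) => *;
  apply: bool_irrelevance.
Defined.

Lemma functorP (C D : category) (F G : functor C D)
  (e : (F : C -> D) = G) :
  (forall x y (f : hom x y),
    ecast a (hom (a x) (a y)) e (fmap F f) = fmap G f) -> F = G.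
Proof.
case: F G e => [o m p q] [o' m' p' q'] /= e; case: _ / e m' p' q' => m' p' q' /= e.
have {}e : m = m'.
  by do 3![apply: functional_extensionality_dep => ?]; apply: e.
by case: _ / e p' q' => p' q'; congr Functor; apply: Prop_irrelevance.
Qed.

Definition nerve (C : category) : sset.
Proof.
refine (@SSet (fun n => functor (ordcat n) C)
  (fun m n f S => compf S (ordfun f)) _ _).
- move=> n S.
  apply: (@functorP _ _ (compf S (ordfun (ohid _))) S (erefl (fobj S))) => i j h.
  by rewrite /=; congr fmap; apply: bool_irrelevance.
- move=> m n p g f S.
  apply: (@functorP _ _ (compf S (ordfun (ohcomp g f)))
    (compf (compf S (ordfun g)) (ordfun f)) erefl) => i j h.
  by rewrite /=; congr fmap; apply: bool_irrelevance.
Defined.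

Definition nerve_map (C D : category) (F : functor C D) :
  smap (nerve C) (nerve D).
Proof.
refine (@SMap (nerve C) (nerve D) (fun n S => compf F S) _).
move=> m n f S.
by apply: (@functorP _ _ (compf F (compf S (ordfun f)))
  (compf (compf F S) (ordfun f)) erefl).
Defined.

Definition nerve_vtx (C : category) (x : C) : nerve C 0 := constf (ordcat 0) x.
Arguments nerve_vtx : clear implicits.

(** The value [hcat X] at X of the left adjoint h of the nerve, in its standard
    presentation: the free category on the graph of vertices and edges of X,
    modulo the congruence generated by degen x = id and d1 s = d0 s . d2 s for
    all vertices x and all 2-simplices s. An edge goes from its vertex 0 to its
    vertex 1; a path lists its edges from source to target. *)

Definition vtx (X : sset) n (k : 'I_n.+1) (x : X n) : X 0 := act (ohcst 1 k) x.
Definition face (X : sset) n (k : 'I_n.+2) (x : X n.+1) : X n :=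
  act (coface k) x.
Definition esrc (X : sset) (e : X 1) : X 0 := vtx ord0 e.
Definition etgt (X : sset) (e : X 1) : X 0 := vtx ord_max e.
Definition degen (X : sset) (x : X 0) : X 1 := act (ohcst 2 ord0) x.

Fixpoint chain (X : sset) (x : X 0) (s : seq (X 1)) (y : X 0) : Prop :=
  if s is e :: s' then esrc e = x /\ chain (etgt e) s' y else x = y.

Lemma chain_cat (X : sset) (x y z : X 0) s t :
  chain x s y -> chain y t z -> chain x (s ++ t) z.
Proof.
elim: s x => [x -> //|e s IHs] x /= [ex es] ht; split=> //; exact: IHs.
Qed.

Record epath (X : sset) (x y : X 0) := Epath {
  epval :> seq (X 1);
  epP : chain x epval y }.

#[warnings="-redundant-canonical-projection"]
HB.instance Definition _ (X : sset) (x y : X 0) := gen_eqMixin (epath x y).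
#[warnings="-redundant-canonical-projection"]
HB.instance Definition _ (X : sset) (x y : X 0) := gen_choiceMixin (epath x y).

Lemma epath_inj (X : sset) (x y : X 0) (p q : epath x y) :
  epval p = epval q -> p = q.
Proof.
case: p q => [s sP] [t tP] /= e; case: _ / e in tP *.
by congr Epath; apply: Prop_irrelevance.
Qed.

Definition epath_cat (X : sset) (x y z : X 0) (p : epath x y) (q : epath y z) :
  epath x z := Epath (chain_cat (epP p) (epP q)).

(* Membership of the listed edges in [epath x y] pins down the endpoints, e.g.
   in [hcong_tri], x and y are the vertices 0 and 2 of s. *)
Inductive hcong (X : sset) :
  forall x y : X 0, epath x y -> epath x y -> Prop :=
| hcong_refl x y (p : epath x y) : hcong p p
| hcong_sym x y (p q : epath x y) : hcong p q -> hcong q p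
| hcong_trans x y (p q r : epath x y) : hcong p q -> hcong q r -> hcong p r
| hcong_cat x y z (p p' : epath x y) (q q' : epath y z) :
    hcong p p' -> hcong q q' -> hcong (epath_cat p q) (epath_cat p' q')
| hcong_degen x (p q : epath x x) :
    epval p = [:: degen x] -> epval q = [::] -> hcong p q
| hcong_tri x y (s : X 2) (p q : epath x y) :
    epval p = [:: face (ord_max : 'I_3) s; face (ord0 : 'I_3) s] ->
    epval q = [:: face (@Ordinal 3 1 isT) s] -> hcong p q.

Definition hcongb (X : sset) (x y : X 0) : rel (epath x y) :=
  fun p q => `[< hcong p q >].

Lemma hcongb_equiv (X : sset) (x y : X 0) : equiv_class_of (@hcongb X x y).
Proof.
split=> [p|p q|q p r].
- by apply/asboolP; apply: hcong_refl.
- by apply/asboolP/asboolP; apply: hcong_sym.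
- by move=> /asboolP pq /asboolP qr; apply/asboolP; apply: hcong_trans qr.
Qed.

Definition hcong_equiv (X : sset) (x y : X 0) : equiv_rel (epath x y) :=
  EquivRelPack (@hcongb_equiv X x y).

Definition hhom (X : sset) (x y : X 0) : Type := {eq_quot (hcong_equiv x y)}.

Definition hclass (X : sset) (x y : X 0) (p : epath x y) : hhom x y :=
  \pi_({eq_quot (hcong_equiv x y)}) p.

Definition hrepr (X : sset) (x y : X 0) (a : hhom x y) : epath x y :=
  repr (a : {eq_quot (hcong_equiv x y)}).

Lemma hreprK (X : sset) (x y : X 0) (a : hhom x y) : hclass (hrepr a) = a.
Proof. exact: reprK. Qed.

Lemma hclassP (X : sset) (x y : X 0) (p q : epath x y) :
  hclass p = hclass q <-> hcong p q.
Proof.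
by split=> [/(@eqmodP _ (hcong_equiv x y)) /asboolP|/asboolP h] //;
  apply/(@eqmodP _ (hcong_equiv x y)).
Qed.

Lemma hrepr_class (X : sset) (x y : X 0) (p : epath x y) :
  hcong (hrepr (hclass p)) p.
Proof. by apply/hclassP; rewrite hreprK. Qed.

Definition epath_nil (X : sset) (x : X 0) : epath x x :=
  @Epath X x x [::] erefl.

Definition epath_edge (X : sset) (x y : X 0) (e : X 1)
  (ex : esrc e = x) (ey : etgt e = y) : epath x y :=
  @Epath X x y [:: e] (conj ex ey).

Definition hcmp (X : sset) (x y z : X 0) (b : hhom y z) (a : hhom x y) :
  hhom x z := hclass (epath_cat (hrepr a) (hrepr b)).

Lemma hcmp_class (X : sset) (x y z : X 0) (q : epath y z) (p : epath x y) :
  hcmp (hclass q) (hclass p) = hclass (epath_cat p q).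
Proof. by apply/hclassP; apply: hcong_cat; apply: hrepr_class. Qed.

Definition hcat (X : sset) : category.
Proof.
refine (@Category (X 0) (@hhom X) (fun x => hclass (epath_nil x))
  (@hcmp X) _ _ _).
- move=> x y f; rewrite -(hreprK f) hcmp_class; congr hclass.
  by apply: epath_inj; rewrite /= cats0.
- move=> x y f; rewrite -(hreprK f) hcmp_class; congr hclass.
  exact: epath_inj.
- move=> x y z t h g f; rewrite -(hreprK f) -(hreprK g) -(hreprK h) !hcmp_class.
  by congr hclass; apply: epath_inj; rewrite /= catA.
Defined.

Lemma vtx_map (X Y : sset) (f : smap X Y) n (k : 'I_n.+1) (x : X n) :
  f _ (vtx k x) = vtx k (f _ x).
Proof. exact: smap_act. Qed.

Lemma chain_map (X Y : sset) (f : smap X Y) (x y : X 0) s :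
  chain x s y -> chain (f _ x) (map (f 1) s) (f _ y).
Proof.
elim: s x => [x -> //|e s IHs] x /= [<- /IHs].
by rewrite /esrc /etgt !vtx_map.
Qed.

Definition epath_map (X Y : sset) (f : smap X Y) (x y : X 0) (p : epath x y) :
  epath (f _ x) (f _ y) := Epath (chain_map f (epP p)).

Lemma hcong_map (X Y : sset) (f : smap X Y) (x y : X 0) (p q : epath x y) :
  hcong p q -> hcong (epath_map f p) (epath_map f q).
Proof.
elim=> {x y p q} [x y p|x y p q _|x y p q r _ pq _ qr|x y z p p' q q' _ pp _ qq|x p q ep eq|x y s p q ep eq].
- exact: hcong_refl.
- exact: hcong_sym.
- exact: hcong_trans qr.
- have e a b : epath_map f (@epath_cat _ x y z a b) =
               epath_cat (epath_map f a) (epath_map f b).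
    by apply: epath_inj; rewrite /= map_cat.
  by rewrite !e; apply: hcong_cat.
- apply: hcong_degen; rewrite /= ?ep ?eq //= /degen.
  by rewrite smap_act.
- by apply: (@hcong_tri _ _ _ (f _ s)); rewrite /= ?ep ?eq /= /face !smap_act.
Qed.

Definition hmap (X Y : sset) (f : smap X Y) : functor (hcat X) (hcat Y).
Proof.
refine (@Functor (hcat X) (hcat Y) (f 0)
  (fun x y (a : hhom x y) => hclass (epath_map f (hrepr a))) _ _).
- move=> x /=; apply/hclassP.
  apply: hcong_trans (hcong_map f (hrepr_class (epath_nil x))) _.
  by rewrite (_ : epath_map _ _ = epath_nil _); [apply: hcong_refl|apply: epath_inj].
- move=> x y z b a /=; rewrite hcmp_class; apply/hclassP.
  apply: hcong_trans (hcong_map f (hrepr_class _)) _.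
  rewrite (_ : epath_map _ _ =
    epath_cat (epath_map f (hrepr a)) (epath_map f (hrepr b))).
    exact: hcong_refl.
  by apply: epath_inj; rewrite /= map_cat.
Defined.

(** The 2-cells: hom'(A, B) = h(B^A), a simplicial map f : A -> B being the
    vertex [name f] of B^A. *)

Definition name (A B : sset) (f : smap A B) : ihom A B 0.
Proof.
refine (@SMap (sprod (stdsimplex 0) A) B (fun n sx => f n sx.2) _).
by move=> m n g [s x]; apply: smap_act.
Defined.

Definition hom_cat (A B : sset) : category := hcat (ihom A B).

Definition cell (A B : sset) (f g : smap A B) : Type :=
  @hom (hom_cat A B) (name f) (name g).

(* Identities between composites of simplicial maps, such as associativity, are
   not conversions; 2-cells are transported along them by [cast_cell]. *)
Definition cast_hom (C : category) (x x' y y' : C) (ex : x = x') (ey : y = y')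
  (f : hom x y) : hom x' y' :=
  ecast z (hom x' z) ey (ecast z (hom z y) ex f).

Definition cast_cell (A B : sset) (f f' g g' : smap A B)
  (ef : f = f') (eg : g = g') (a : cell f g) : cell f' g' :=
  @cast_hom (hom_cat A B) _ _ _ _
    (congr1 (@name A B) ef) (congr1 (@name A B) eg) a.

Lemma compsA (X Y Z T : sset) (h : smap Z T) (g : smap Y Z) (f : smap X Y) :
  h \os (g \os f) = h \os g \os f.
Proof. exact: smapP. Qed.

Definition postcomp (X A B : sset) (k : smap A B) : smap (ihom X A) (ihom X B).
Proof.
refine (@SMap (ihom X A) (ihom X B) (fun n u => k \os u) _).
by move=> m n f u; apply: smapP.
Defined.

Lemma postcomp_name (X A B : sset) (k : smap A B) (f : smap X A) :
  postcomp X k 0 (name f) = name (k \os f).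
Proof. exact: smapP. Qed.

Definition whiskl (X A B : sset) (k : smap A B) (f g : smap X A)
  (a : cell f g) : cell (k \os f) (k \os g) :=
  @cast_hom (hom_cat X B) _ _ _ _ (postcomp_name k f) (postcomp_name k g)
    (fmap (hmap (postcomp X k)) a).

Definition precomp_simp (X Y B : sset) (u : smap X Y) n (s : ihom Y B n) :
  ihom X B n.
Proof.
refine (@SMap (sprod (stdsimplex n) X) B (fun m sx => smf s m (sx.1, u m sx.2)) _).
by move=> m p f [t x] /=; rewrite -smap_act /= smap_act.
Defined.

Definition precomp (X Y B : sset) (u : smap X Y) : smap (ihom Y B) (ihom X B).
Proof.
refine (@SMap (ihom Y B) (ihom X B) (@precomp_simp X Y B u) _).
by move=> m n f s; apply: smapP.
Defined.

Lemma precomp_name (X Y B : sset) (u : smap X Y) (f : smap Y B) :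
  precomp B u 0 (name f) = name (f \os u).
Proof. exact: smapP. Qed.

Definition whiskr (X A B : sset) (f g : smap A B) (a : cell f g)
  (x : smap X A) : cell (f \os x) (g \os x) :=
  @cast_hom (hom_cat X B) _ _ _ _ (precomp_name x f) (precomp_name x g)
    (fmap (hmap (precomp B x)) a).

Definition abs_left_lifting (A B C : sset) (f : smap B A) (g : smap C A)
  (l : smap C B) (lam : cell g (f \os l)) : Prop :=
  forall X : sset, quasi_category X ->
  forall (b : smap X B) (x : smap X C) (chi : cell (g \os x) (f \os b)),
  exists! zeta : cell (l \os x) b,
    chi = cmp (whiskl f zeta)
              (cast_cell erefl (esym (compsA f l x)) (whiskr lam x)).
Arguments abs_left_lifting {A B C} f g l lam.

(** The action of B^(-) on 2-cells, obtained by applying h to the simplicial map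
    Y^X -> (B^X)^(B^Y) sending u : Delta^n x X -> Y to the map
    (t, s) |-> ((t', x) |-> s(t', u(t t', x))). *)

Definition powmap1 (X Y B : sset) n (u : ihom X Y n) m
  (ts : sprod (stdsimplex n) (ihom Y B) m) : ihom X B m.
Proof.
refine (@SMap (sprod (stdsimplex m) X) B
  (fun p tx => smf ts.2 p (tx.1, smf u p (ohcomp ts.1 tx.1, tx.2))) _).
move=> p q f [t x] /=.
by rewrite -smap_act /= -smap_act.
Defined.

Definition powmap_simp (X Y B : sset) n (u : ihom X Y n) :
  ihom (ihom Y B) (ihom X B) n.
Proof.
refine (@SMap (sprod (stdsimplex n) (ihom Y B)) (ihom X B) (powmap1 u) _).
by move=> m p f [t s]; apply: smapP.
Defined.

Definition powmap (X Y B : sset) :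
  smap (ihom X Y) (ihom (ihom Y B) (ihom X B)).
Proof.
refine (@SMap (ihom X Y) (ihom (ihom Y B) (ihom X B)) (@powmap_simp X Y B) _).
by move=> m n f u; apply: smapP => p [t s]; apply: smapP.
Defined.

Lemma powmap_name (X Y B : sset) (u : smap X Y) :
  powmap X Y B 0 (name u) = name (precomp B u).
Proof. by apply: smapP => p [t s]; apply: smapP. Qed.

Definition pow_cell (X Y B : sset) (u v : smap X Y) (a : cell u v) :
  cell (precomp B u) (precomp B v) :=
  @cast_hom (hom_cat (ihom Y B) (ihom X B)) _ _ _ _
    (powmap_name B u) (powmap_name B v) (fmap (hmap (powmap X Y B)) a).

(** The edge of (N D)^(N C) given by a natural transformation F => G, regarded
    as a functor [1] x C -> D that is F over 0 and G over 1. *)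

Section NatCell.
Variables (C D : category) (F G : functor C D) (nu : nattrans F G).

Definition nt_ob (b : bool) (x : C) : D := if b then G x else F x.

Definition nt_mor (b b' : bool) : b ==> b' -> forall x y : C,
  hom x y -> hom (nt_ob b x) (nt_ob b' y) :=
  match b, b' return b ==> b' -> forall x y : C,
    hom x y -> hom (nt_ob b x) (nt_ob b' y) with
  | false, false => fun _ x y f => fmap F f
  | false, true => fun _ x y f => cmp (nu y) (fmap F f)
  | true, true => fun _ x y f => fmap G f
  | true, false => fun h => False_rect _ (notF h)
  end.

Lemma nt_mor_id b (h : b ==> b) x : nt_mor h (idm x) = idm (nt_ob b x).
Proof. by case: b h => h; apply: fmap_id. Qed.

Lemma nt_mor_cmp b1 b2 b3 (h12 : b1 ==> b2) (h23 : b2 ==> b3) (h13 : b1 ==> b3)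
  x y z (g : hom y z) (f : hom x y) :
  nt_mor h13 (cmp g f) = cmp (nt_mor h23 g) (nt_mor h12 f).
Proof.
case: b1 b2 b3 h12 h23 h13 => -[] [] //= _ _ _; rewrite fmap_cmp ?cmpA //.
by rewrite nt_nat.
Qed.

Lemma nt_le n (s : ordhom n.+1 2) (i j : 'I_n.+1) :
  (i <= j)%N -> (0 < s i)%N ==> (0 < s j)%N.
Proof. by move=> /(ohP s) sij; apply/implyP => /leq_trans; apply. Qed.

Definition nt_simp n (sS : sprod (stdsimplex 1) (nerve C) n) : nerve D n.
Proof.
refine (@Functor (ordcat n) D (fun i => nt_ob (0 < sS.1 i)%N (sS.2 i))
  (fun i j h => nt_mor (nt_le sS.1 h) (fmap sS.2 h)) _ _).
- by move=> i; rewrite fmap_id nt_mor_id.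
- by move=> i j k g f; rewrite fmap_cmp; apply: nt_mor_cmp.
Defined.

Definition nt_edge : ihom (nerve C) (nerve D) 1.
Proof.
refine (@SMap (sprod (stdsimplex 1) (nerve C)) (nerve D) nt_simp _).
move=> m n f sS.
apply: (@functorP _ _ (nt_simp (act f sS)) (compf (nt_simp sS) (ordfun f)) erefl).
move=> i j h; exact: (congr1 (fun p => nt_mor p (fmap sS.2 (ohP f h)))
  (bool_irrelevance _ _)).
Defined.

Lemma nt_edge_src : esrc nt_edge = name (nerve_map F).
Proof.
apply: smapP => n [s S].
by apply: (@functorP _ _ (smf (esrc nt_edge) n (s, S)) (compf F S) erefl).
Qed.

Lemma nt_edge_tgt : etgt nt_edge = name (nerve_map G).
Proof.
apply: smapP => n [s S].
by apply: (@functorP _ _ (smf (etgt nt_edge) n (s, S)) (compf G S) erefl).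
Qed.

Definition nt_cell : cell (nerve_map F) (nerve_map G) :=
  hclass (epath_edge nt_edge_src nt_edge_tgt).

End NatCell.

(* The constant diagram functor B -> B^X. *)
Definition diag (X B : sset) : smap B (ihom X B).
Proof.
refine (@SMap B (ihom X B) (fun n b =>
  @SMap (sprod (stdsimplex n) X) B (fun m sx => act sx.1 b)
    (fun m p f sx => act_comp sx.1 f b)) _).
by move=> m n f b; apply: smapP => p [s x]; rewrite /= act_comp.
Defined.

Definition eval (Y B : sset) (y : Y 0) : smap (ihom Y B) B.
Proof.
refine (@SMap (ihom Y B) B
  (fun n s => smf s n (ohid n.+1, act (ohcst n.+1 ord0) y)) _).
by move=> m n f s; rewrite -smap_act /=; congr (smf s _ (_, _)); rewrite -act_comp.
Defined.

Lemma precomp_constf (J D : category) (t : D) (B : sset) :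
  precomp B (nerve_map (constf J t)) = diag (nerve J) B \os eval B (nerve_vtx D t).
Proof.
apply: smapP => n s; apply: smapP => m [a S].
rewrite /= -smap_act /=; congr (smf s _ (_, _)); first exact: ordhomP.
exact: (@functorP _ _ (compf (constf J t) S)
  (compf (compf (nerve_vtx D t) (ordfun (ohcst n.+1 ord0))) (ordfun a)) erefl).
Qed.

(* B^(-) applied to the unique natural transformation from F to the constant
   functor at a terminal object t. *)
Definition kappa (J D : category) (F : functor J D) (t : D) (ht : terminal t)
  (B : sset) :
  cell (precomp B (nerve_map F)) (diag (nerve J) B \os eval B (nerve_vtx D t)) :=
  cast_cell erefl (precomp_constf J t B) (pow_cell B (nt_cell (to_terminal F ht))).

Definition yoneda (X : sset) n (x : X n) : smap (stdsimplex n) X :=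
  @SMap (stdsimplex n) X (fun m a => act a x) (fun m p f a => act_comp a f x).

(* A vertex x of Y is also the map [yoneda x] : Delta^0 -> Y; in particular a
   diagram d : X -> B is the map [yoneda (name d)] : Delta^0 -> B^X. *)
Definition colimit_cone (X B : sset) (d : smap X B) (l : B 0)
  (lam : cell (yoneda (name d)) (diag X B \os yoneda l)) : Prop :=
  abs_left_lifting (diag X B) (yoneda (name d)) (yoneda l) lam.
Arguments colimit_cone {X B} d l lam.

Lemma precomp_yoneda (X Y B : sset) (u : smap X Y) (f : smap Y B) :
  precomp B u \os yoneda (name f) = yoneda (name (f \os u)).
Proof. by apply: smapP => n a; apply: smapP. Qed.

Lemma eval_yoneda (X Y B : sset) (y : Y 0) (f : smap Y B) :
  diag X B \os eval B y \os yoneda (name f) = diag X B \os yoneda (f 0 y).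
Proof.
apply: smapP => n a; apply: smapP => m [b x] /=.
by rewrite smap_act; congr (act _ (act _ _)); apply: ordhomP => i; rewrite !ord1.
Qed.

(* The component of [kappa] at the vertex F of B^D, a cone under the restriction
   of F to J with summit F t. *)
Definition terminal_cone (J D : category) (u : functor J D) (t : D)
  (ht : terminal t) (B : sset) (F : smap (nerve D) B) :
  cell (yoneda (name (F \os nerve_map u)))
       (diag (nerve J) B \os yoneda (F 0 (nerve_vtx D t))) :=
  cast_cell (precomp_yoneda (nerve_map u) F) (eval_yoneda (nerve J) _ F)
    (whiskr (kappa u ht B) (yoneda (name F))).

Lemma restrict_yoneda (X Y B : sset) (u : smap X Y) (f : smap Y B)
  (d : smap X B) : f \os u = d -> yoneda (name (f \os u)) = yoneda (name d).
Proof. by move=> ->. Qed.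

Definition NDop : sset := nerve (opcat Delta).
Definition NDplus : sset := nerve (opcat DeltaPlus).
Definition NDinf : sset := nerve DeltaInf.

(* The cone under d defined by an augmented simplicial object X extending d; the
   empty ordinal is the terminal object of [opcat DeltaPlus]. *)
Definition aug_cone (B : sset) (d : smap NDop B)
  (X : smap NDplus B)
  (hX : X \os nerve_map incl_Delta = d) :
  cell (yoneda (name d))
    (diag NDop B \os yoneda (X 0 (nerve_vtx (opcat DeltaPlus) 0))) :=
  cast_cell (restrict_yoneda hX) erefl
    (terminal_cone incl_Delta terminal_empty X).

Lemma split_apex (B : sset) (X : smap NDplus B)
  (D : smap NDinf B) (hD : D \os nerve_map incl_split = X) :
  diag NDop B \os yoneda (X 0 (nerve_vtx (opcat DeltaPlus) 0)) =
  diag NDop B \os yoneda (D 0 (nerve_vtx DeltaInf 0)).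
Proof.
congr (_ \os yoneda _); rewrite -hD /=; congr (D 0 _).
apply: (@functorP _ _ (compf incl_split (nerve_vtx (opcat DeltaPlus) 0))
  (nerve_vtx DeltaInf 0) erefl).
by move=> i j h; apply: tophomP => k; apply: etrans (ord1 _) (esym (ord1 _)).
Qed.

Definition res (B : sset) :
  smap (ihom NDinf B) (ihom NDop B) :=
  precomp B (nerve_map incl_DeltaInf).

Definition ev0 (B : sset) : smap (ihom NDinf B) B :=
  eval B (nerve_vtx DeltaInf 0).

Definition kappa_split (B : sset) : cell (res B) (diag NDop B \os ev0 B) :=
  kappa incl_DeltaInf terminal_Delta0 B.

Lemma postcomp_diag (B A : sset) (k : smap B A) :
  postcomp NDop k \os (diag NDop B \os ev0 B) =
  diag NDop A \os (k \os ev0 B).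
Proof.
apply: smapP => n s; apply: smapP => m [a S] /=.
by rewrite smap_act.
Qed.

(* Main.v *)
(* Write J = Delta^op, D = Delta_infty and u : J -> D for the inclusion. The
   splitting is packaged by the decalage w : J -> J, [n] |-> [n+1], with
   transformations eps : w => 1, p : w => const [0] and theta : u => u w, and a
   map e : [0] -> u [0] of D, subject to
     u eps . theta = 1   and   u p . theta = e . !
   where ! is the map to the terminal object [0] of D. These are equations
   between natural transformations, so the 2-functor B^(-) transports them to
   2-cells, for an arbitrary simplicial set B. The factorization of
   chi : res y => c b through kappa y is
     zeta = ev_[0] chi . B^e y : ev_0 y => ev_[0] res y => b.
   It is unique because ! e = 1. It is a factorization because
     c zeta . kappa y = c ev_[0] chi . B^(e !) y
                      = c ev_[0] chi . B^(u p) y . B^theta y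
                      = B^w chi . B^theta y
                      = chi . B^(u eps) y . B^theta y = chi,
   the two middle steps being the naturality of B^p and B^eps at chi, together
   with the triviality of B^p and B^eps on constant diagrams. The argument
   applies to every y : X -> B^D; taking for y a vertex of B^D, or the composite
   of k^D : B^D -> A^D with a map to B^D, gives the last two assertions. *)

Require Import Defs.
From mathcomp Require Import ssrfun.
From mathcomp Require Import all_boot boolp.

Set Implicit Arguments.
Unset Strict Implicit.
Unset Printing Implicit Defensive.

Local Open Scope qcat_scope.

(** * Congruence of edge-paths *)

(* Edge-paths are compared as bare lists of edges, so that the transports of
   2-cells along equalities of their endpoints disappear. *)
Definition path_cong (X : sset) (x y : X 0) (s t : seq (X 1)) : Prop :=
  exists (hs : chain x s y) (ht : chain x t y), hcong (Epath hs) (Epath ht).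

Section PathCong.
Variable X : sset.
Implicit Types (x y z : X 0) (s t r : seq (X 1)).

Lemma path_cong_refl x y s : chain x s y -> path_cong x y s s.
Proof. by move=> h; exists h, h; apply: hcong_refl. Qed.

Lemma path_cong_sym x y s t : path_cong x y s t -> path_cong x y t s.
Proof. by move=> [hs [ht h]]; exists ht, hs; apply: hcong_sym. Qed.

Lemma path_cong_trans x z s t r :
  path_cong x z s t -> path_cong x z t r -> path_cong x z s r.
Proof.
move=> [hs [ht h]] [ht' [hr h']]; exists hs, hr; apply: hcong_trans h _.
by rewrite (Prop_irrelevance ht ht').
Qed.

Lemma path_cong_cat x y z s s' t t' :
  path_cong x y s s' -> path_cong y z t t' -> path_cong x z (s ++ t) (s' ++ t').
Proof.
move=> [hs [hs' h]] [ht [ht' h']].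
exists (chain_cat hs ht), (chain_cat hs' ht').
exact: (hcong_cat h h').
Qed.

Lemma path_cong_catl x y z s t t' :
  chain x s y -> path_cong y z t t' -> path_cong x z (s ++ t) (s ++ t').
Proof. by move=> /path_cong_refl; apply: path_cong_cat. Qed.

Lemma path_cong_catr x y z s s' t :
  path_cong x y s s' -> chain y t z -> path_cong x z (s ++ t) (s' ++ t).
Proof. by move=> h /path_cong_refl; apply: path_cong_cat. Qed.

Lemma esrc_degen x : esrc (degen x) = x.
Proof.
rewrite /esrc /degen /vtx -act_comp -[RHS]act_id; congr (act _ _).
by apply: ordhomP => i; rewrite !ord1.
Qed.

Lemma etgt_degen x : etgt (degen x) = x.
Proof.
rewrite /etgt /degen /vtx -act_comp -[RHS]act_id; congr (act _ _).
by apply: ordhomP => i; rewrite !ord1.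
Qed.

Lemma path_cong_degen x : path_cong x x [:: degen x] [::].
Proof.
have h : chain x [:: degen x] x by rewrite /= esrc_degen etgt_degen.
by exists h, erefl; apply: hcong_degen.
Qed.

Lemma path_cong_tri x y (a : X 2) :
  esrc (face (ord_max : 'I_3) a) = x -> etgt (face (ord0 : 'I_3) a) = y ->
  path_cong x y [:: face (ord_max : 'I_3) a; face (ord0 : 'I_3) a]
                [:: face (@Ordinal 3 1 isT) a].
Proof.
move=> ex ey.
have h1 : chain x [:: face (ord_max : 'I_3) a; face (ord0 : 'I_3) a] y.
  split=> //; split=> //; rewrite /esrc /etgt /face /vtx -!act_comp.
  by congr (act _ _); apply: ordhomP => i; apply: val_inj.
have h2 : chain x [:: face (@Ordinal 3 1 isT) a] y.
  rewrite /= -ex -ey /esrc /etgt /face /vtx -!act_comp.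
  by split; congr (act _ _); apply: ordhomP => i; apply: val_inj.
by exists h1, h2; apply: hcong_tri.
Qed.

End PathCong.

Section SmapEdges.
Variables (X Y : sset) (f : smap X Y).

Lemma esrc_map (e : X 1) : esrc (f 1 e) = f 0 (esrc e).
Proof. by rewrite /esrc vtx_map. Qed.

Lemma etgt_map (e : X 1) : etgt (f 1 e) = f 0 (etgt e).
Proof. by rewrite /etgt vtx_map. Qed.

Lemma degen_map (x : X 0) : degen (f 0 x) = f 1 (degen x).
Proof. by rewrite /degen smap_act. Qed.

Lemma face_map n (k : 'I_n.+2) (a : X n.+1) :
  face k (f n.+1 a) = f n (face k a).
Proof. by rewrite /face smap_act. Qed.

End SmapEdges.

Lemma path_cong_map (X Y : sset) (f : smap X Y) x y s t :
  path_cong x y s t ->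
  path_cong (f _ x) (f _ y) (map (f 1) s) (map (f 1) t).
Proof.
move=> [hs [ht h]]; exists (chain_map f hs), (chain_map f ht).
exact: (hcong_map f h).
Qed.

(** A relation rather than a chosen representative: a list of edges does not mention its endpoints
    in its type, so it also represents every transport of the morphism by [cast_hom]. *)
Definition represents (X : sset) (x y : X 0) (s : seq (X 1)) (a : hhom x y) :=
  exists h : chain x s y, a = hclass (Epath h).

Section Represents.
Variable X : sset.

Lemma represents_class (x y : X 0) (p : epath x y) : represents p (hclass p).
Proof. by exists (epP p); congr hclass; apply: epath_inj. Qed.

Lemma representsP (x y : X 0) (a : hhom x y) : exists s, represents s a.
Proof.
by exists (hrepr a); have := represents_class (hrepr a); rewrite hreprK.
Qed.

Lemma represents_chain (x y : X 0) s (a : hhom x y) :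
  represents s a -> chain x s y.
Proof. by case. Qed.

Lemma represents_eq (x y : X 0) s t (a b : hhom x y) :
  represents s a -> represents t b -> a = b <-> path_cong x y s t.
Proof.
move=> [hs ->] [ht ->]; rewrite hclassP; split=> [h|[hs' [ht' h]]].
  by exists hs, ht.
by rewrite (Prop_irrelevance hs hs') (Prop_irrelevance ht ht').
Qed.

Lemma represents_cast (x x' y y' : X 0) (ex : x = x') (ey : y = y') s
    (a : hhom x y) :
  represents s a -> represents s (@cast_hom (hcat X) _ _ _ _ ex ey a).
Proof. by case: _ / ex; case: _ / ey. Qed.

Lemma represents_cmp (x y z : X 0) s t (a : hhom x y) (b : hhom y z) :
  represents s a -> represents t b -> represents (s ++ t) (hcmp b a).
Proof. by move=> [hs ->] [ht ->]; rewrite hcmp_class; eexists. Qed.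

End Represents.

Lemma represents_map (X Y : sset) (f : smap X Y) (x y : X 0) s (a : hhom x y) :
  represents s a -> represents (map (f 1) s) (fmap (hmap f) a).
Proof.
move=> [hs ->]; exists (chain_map f hs); apply/hclassP.
exact: hcong_map (hrepr_class _).
Qed.

(** The boolean [~~ b] is read as 0 or 1: the values are 0, 1, 1 for [true] and 0, 0, 1 for
    [false]. *)
Definition codegeneracy (b : bool) : ordhom 3 2.
Proof.
refine (@Ordhom 3 2 (fun i => inord (~~ b < i)) _) => i j ij.
rewrite !inordK ?ltnS ?leq_b1 //.
by case: (ltnP _ i) => // h; rewrite (leq_trans h ij).
Defined.

(* The square is cut along the diagonal [Phi (a, b)]; the two triangles are the
   images of pairs of degenerate 2-simplices. *)
Lemma path_cong_square (P Q R : sset) (Phi : smap (sprod P Q) R) (a : P 1)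
    (b : Q 1) :
  path_cong (Phi 0 (esrc a, esrc b)) (Phi 0 (etgt a, etgt b))
    [:: Phi 1 (degen (esrc a), b); Phi 1 (a, degen (etgt b))]
    [:: Phi 1 (a, degen (esrc b)); Phi 1 (degen (etgt a), b)].
Proof.
have sigma (S : sset) (e : S 1) (c : bool) :
  [/\ face (ord_max : 'I_3) (act (codegeneracy c) e) =
        if c then e else degen (esrc e),
      face (ord0 : 'I_3) (act (codegeneracy c) e) =
        if c then degen (etgt e) else e
    & face (@Ordinal 3 1 isT) (act (codegeneracy c) e) = e].
  (* Writing [e] as acted on by the identity of [1] reduces each equation to one between maps of
     ordinals. *)
  have eE : e = act (ohid 2) e by rewrite act_id.
  rewrite /face /degen /esrc /etgt /vtx -!act_comp.
  split; case: c; rewrite ?[X in _ = X]eE; congr (act _ _);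
    by apply: ordhomP => -[[|[|//]] ?]; apply: val_inj; rewrite /= ?inordK.
(* The path runs first along [a] if [c] is true and first along [b] otherwise; in both triangles the
   middle face is the diagonal. *)
have tri c : path_cong (Phi 0 (esrc a, esrc b)) (Phi 0 (etgt a, etgt b))
    [:: Phi 1 (if c then a else degen (esrc a),
               if c then degen (esrc b) else b);
        Phi 1 (if c then degen (etgt a) else a,
               if c then b else degen (etgt b))]
    [:: Phi 1 (a, b)].
  have [a2 a0 a1] := sigma _ a c; have [b2 b0 b1] := sigma _ b (~~ c).
  have := @path_cong_tri _ (Phi 0 (esrc a, esrc b)) (Phi 0 (etgt a, etgt b))
    (Phi 2 (act (codegeneracy c) a, act (codegeneracy (~~ c)) b)).
  rewrite !face_map /= -!/(face _ _) a2 a0 a1 b2 b0 b1 !if_neg; apply.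
    rewrite esrc_map; congr (Phi 0 (_, _)).
      by case: c {a2 a0 a1 b2 b0 b1} => //; apply: esrc_degen.
    by case: c {a2 a0 a1 b2 b0 b1} => //; apply: esrc_degen.
  rewrite etgt_map; congr (Phi 0 (_, _)).
    by case: c {a2 a0 a1 b2 b0 b1} => //; apply: etgt_degen.
  by case: c {a2 a0 a1 b2 b0 b1} => //; apply: etgt_degen.
exact: path_cong_trans (tri false) (path_cong_sym (tri true)).
Qed.

(** Pasting of squares, one for each edge of [s]: the edge [a] is moved from the end of the path to
    its beginning. *)
Lemma path_cong_natural (P Q R : sset) (Phi : smap (sprod P Q) R) (a : P 1)
    (q q' : Q 0) (s : seq (Q 1)) :
  chain q s q' ->
  path_cong (Phi 0 (esrc a, q)) (Phi 0 (etgt a, q'))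
    (map (fun b => Phi 1 (degen (esrc a), b)) s ++ [:: Phi 1 (a, degen q')])
    (Phi 1 (a, degen q) :: map (fun b => Phi 1 (degen (etgt a), b)) s).
Proof.
have src p (b : Q 1) : esrc (Phi 1 (p, b)) = Phi 0 (esrc p, esrc b).
  by rewrite esrc_map.
have tgt p (b : Q 1) : etgt (Phi 1 (p, b)) = Phi 0 (etgt p, etgt b).
  by rewrite etgt_map.
elim: s q => [|b s IHs] q /=.
  by move=> ->; apply: path_cong_refl; rewrite /= src tgt esrc_degen etgt_degen.
move=> [<- hs].
have hl : chain (Phi 0 (esrc a, esrc b)) [:: Phi 1 (degen (esrc a), b)]
                (Phi 0 (esrc a, etgt b)).
  by rewrite /= src tgt esrc_degen etgt_degen.
apply: path_cong_trans (path_cong_catl hl (IHs _ hs)) _.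
have hr p : chain (Phi 0 (p, etgt b)) (map (fun c => Phi 1 (degen p, c)) s)
                (Phi 0 (p, q')).
  elim: s (etgt b) hs {IHs} => [|c s IHs] z /= => [-> //|[<- /IHs]].
  by rewrite src tgt esrc_degen etgt_degen.
exact: path_cong_catr (path_cong_square Phi a b) (hr _).
Qed.

(** * Natural transformations and nerves *)

(* Equality of morphisms whose endpoints are only propositionally equal. *)
Inductive heq (C : category) (x y : C) (f : hom x y) :
  forall x' y' : C, hom x' y' -> Prop := Heq : heq f f.

Lemma heq_cast (C : category) (x y x' y' : C) (f : hom x y) (g : hom x' y') :
  heq f g -> exists (ex : x = x') (ey : y = y'), cast_hom ex ey f = g.
Proof. by case=> {x' y' g}; exists erefl, erefl. Qed.

Lemma heq_eq (C : category) (x y : C) (f g : hom x y) : heq f g -> f = g.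
Proof.
move=> /heq_cast[ex [ey]].
by rewrite (Prop_irrelevance ex erefl) (Prop_irrelevance ey erefl).
Qed.

Lemma eq_heq (C : category) (x y : C) (f g : hom x y) : f = g -> heq f g.
Proof. by move=> ->. Qed.

(** With [heq] there is no explicit transport, so functors out of ordinals can be compared by cases
    on the values of their indices. *)
Lemma functor_heqP (C D : category) (F G : functor C D) :
  (forall x, F x = G x) ->
  (forall x y (f : hom x y), heq (fmap F f) (fmap G f)) -> F = G.
Proof.
case: F G => [o m p q] [o' m' p' q'] /= /funext e.
case: _ / e m' p' q' => m' p' q' h.
apply: (@functorP _ _ (Functor p q) (Functor p' q') erefl) => x y f /=.
exact: heq_eq.
Qed.

Definition nt_id (C D : category) (F : functor C D) : nattrans F F.
Proof.
refine (@Nattrans C D F F (fun x => idm (F x)) _).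
by move=> x y f; rewrite cmp1m cmpm1.
Defined.

Definition nt_comp (C D : category) (F G H : functor C D) (nu : nattrans G H)
  (mu : nattrans F G) : nattrans F H.
Proof.
refine (@Nattrans C D F H (fun x => cmp (nu x) (mu x)) _).
by move=> x y f; rewrite -cmpA nt_nat cmpA nt_nat cmpA.
Defined.

Definition nt_post (C D E : category) (U : functor D E) (F G : functor C D)
  (nu : nattrans F G) : nattrans (compf U F) (compf U G).
Proof.
refine (@Nattrans C E (compf U F) (compf U G) (fun x => fmap U (nu x)) _).
by move=> x y f; rewrite /= -!fmap_cmp nt_nat.
Defined.

Definition nt_const (C D : category) (a b : D) (f : hom a b) :
  nattrans (constf C a) (constf C b).
Proof.
refine (@Nattrans C D (constf C a) (constf C b) (fun=> f) _).
by move=> x y h; rewrite /= cmp1m cmpm1.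
Defined.

Lemma compf_constf (C D E : category) (U : functor D E) (a : D) :
  compf U (constf C a) = constf C (U a).
Proof. by apply: functor_heqP => //= x y f; rewrite fmap_id. Qed.

Lemma nt_edge_eq (C D : category) (F G F' G' : functor C D)
    (nu : nattrans F G) (nu' : nattrans F' G') :
  F = F' -> G = G' -> (forall x, heq (nu x) (nu' x)) ->
  nt_edge nu = nt_edge nu'.
Proof.
move=> eF eG; case: _ / eF nu' => nu'; case: _ / eG nu' => nu' h.
congr nt_edge; case: nu nu' h => [c cP] [c' cP'] /= h.
have {}h : c = c' by apply: functional_extensionality_dep => x; apply: heq_eq.
by case: _ / h in cP' *; congr Nattrans; apply: Prop_irrelevance.
Qed.

Lemma nt_edge_post (C D E : category) (U : functor D E) (F G : functor C D)
    (nu : nattrans F G) :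
  postcomp (nerve C) (nerve_map U) 1 (nt_edge nu) = nt_edge (nt_post U nu).
Proof.
apply: smapP => n [s S]; apply: functor_heqP => [i|i j h] /=.
  by case: (0 < s i)%N.
(* The proof on which [nt_mor] depends is generalised first, so that the two booleans in its type
   can be decided. *)
move: (nt_le s h); case: (0 < s i)%N; case: (0 < s j)%N => //= _.
by rewrite fmap_cmp.
Qed.

Lemma nt_edge_id (C D : category) (F : functor C D) :
  nt_edge (nt_id F) = degen (name (nerve_map F)).
Proof.
apply: smapP => n [s S]; apply: functor_heqP => [i|i j h] /=.
  by case: (0 < s i)%N.
move: (nt_le s h); case: (0 < s i)%N; case: (0 < s j)%N => //= _.
by rewrite cmp1m.
Qed.

(** * Vertical composites as 2-simplices *)

Section NatTriangle.
Variables (C D : category) (F G H : functor C D).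
Variables (mu : nattrans F G) (nu : nattrans G H).

(** The object part of a functor [2] x C -> D. The value at 2 is repeated at all larger numbers, so
    that elements of [2] can be matched as plain numbers. *)
Definition tri_ob (k : nat) (x : C) : D :=
  match k with 0 => F x | 1 => G x | _ => H x end.

Definition tri_mor (k k' : nat) : (k <= k')%N -> forall x y : C,
  hom x y -> hom (tri_ob k x) (tri_ob k' y) :=
  match k, k' return (k <= k')%N -> forall x y : C,
    hom x y -> hom (tri_ob k x) (tri_ob k' y) with
  | 0, 0 => fun _ x y f => fmap F f
  | 0, 1 => fun _ x y f => cmp (mu y) (fmap F f)
  | 0, _.+2 => fun _ x y f => cmp (cmp (nu y) (mu y)) (fmap F f)
  | 1, 1 => fun _ x y f => fmap G f
  | 1, _.+2 => fun _ x y f => cmp (nu y) (fmap G f)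
  | _.+2, _.+2 => fun _ x y f => fmap H f
  | _.+1, 0 => fun h => False_rect _ (notF h)
  | _.+2, 1 => fun h => False_rect _ (notF h)
  end.

Lemma tri_mor_id k (h : (k <= k)%N) x : tri_mor h (idm x) = idm (tri_ob k x).
Proof. by case: k h => [|[|k]] h; apply: fmap_id. Qed.

Lemma tri_mor_cmp k1 k2 k3 (h12 : (k1 <= k2)%N) (h23 : (k2 <= k3)%N)
  (h13 : (k1 <= k3)%N) x y z (g : hom y z) (f : hom x y) :
  tri_mor h13 (cmp g f) = cmp (tri_mor h23 g) (tri_mor h12 f).
Proof.
have natA (F' G' : functor C D) (al : nattrans F' G') a b c (h : hom a b)
  (k : hom c (F' a)) : cmp (al b) (cmp (fmap F' h) k) =
                       cmp (fmap G' h) (cmp (al a) k).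
  by rewrite !cmpA nt_nat.
by case: k1 k2 k3 h12 h23 h13 => [|[|k1]] [|[|k2]] [|[|k3]] //= _ _ _;
  rewrite fmap_cmp -?cmpA ?natA.
Qed.

Definition tri_simp n (sS : sprod (stdsimplex 2) (nerve C) n) : nerve D n.
Proof.
refine (@Functor (ordcat n) D (fun i => tri_ob (sS.1 i) (sS.2 i))
  (fun i j h => tri_mor (ohP sS.1 h) (fmap sS.2 h)) _ _).
- by move=> i; rewrite fmap_id tri_mor_id.
- by move=> i j k g f; rewrite fmap_cmp; apply: tri_mor_cmp.
Defined.

Definition nt_triangle : ihom (nerve C) (nerve D) 2.
Proof.
refine (@SMap (sprod (stdsimplex 2) (nerve C)) (nerve D) tri_simp _).
move=> m n f sS.
apply: (@functorP _ _ (tri_simp (act f sS)) (compf (tri_simp sS) (ordfun f))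
  erefl).
move=> i j h; exact: (congr1 (fun p => tri_mor p (fmap sS.2 (ohP f h)))
  (bool_irrelevance _ _)).
Defined.

Lemma face2_nt_triangle : face (ord_max : 'I_3) nt_triangle = nt_edge mu.
Proof.
(* [bump 2] is the coface omitting 2. For given elements of ['I_2] both sides compute to the same
   morphism, and the case of 1 before 0 is void. *)
have mor (i j : 'I_2) (p : (bump 2 i <= bump 2 j)%N)
    (q : (0 < i)%N ==> (0 < j)%N) x y (f : hom x y) :
    heq (tri_mor p f) (nt_mor mu q f).
  by move: i j p q => [[|[|//]] ?] [[|[|//]] ?].
apply: smapP => n [s S]; apply: functor_heqP => [i|i j h] /=; last exact: mor.
by case: (s i) => [[|[|//]] ?].
Qed.

Lemma face0_nt_triangle : face (ord0 : 'I_3) nt_triangle = nt_edge nu.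
Proof.
have mor (i j : 'I_2) (p : (bump 0 i <= bump 0 j)%N)
    (q : (0 < i)%N ==> (0 < j)%N) x y (f : hom x y) :
    heq (tri_mor p f) (nt_mor nu q f).
  by move: i j p q => [[|[|//]] ?] [[|[|//]] ?].
apply: smapP => n [s S]; apply: functor_heqP => [i|i j h] /=; last exact: mor.
by case: (s i) => [[|[|//]] ?].
Qed.

Lemma face1_nt_triangle : face (@Ordinal 3 1 isT) nt_triangle =
  nt_edge (nt_comp nu mu).
Proof.
have mor (i j : 'I_2) (p : (bump 1 i <= bump 1 j)%N)
    (q : (0 < i)%N ==> (0 < j)%N) x y (f : hom x y) :
    heq (tri_mor p f) (nt_mor (nt_comp nu mu) q f).
  by move: i j p q => [[|[|//]] ?] [[|[|//]] ?].
apply: smapP => n [s S]; apply: functor_heqP => [i|i j h] /=; last exact: mor.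
by case: (s i) => [[|[|//]] ?].
Qed.

End NatTriangle.

(** * The action of natural transformations on diagrams *)

(** Horizontal composition Z^Y x Y^X -> Z^X. At a degenerate edge in either factor it is a
    whiskering, so [path_cong_natural] applied to it is the interchange law. *)
Definition hcomp_simp (X Y Z : sset) n (gf : sprod (ihom Y Z) (ihom X Y) n) :
  ihom X Z n.
Proof.
refine (@SMap (sprod (stdsimplex n) X) Z
  (fun m tx => smf gf.1 m (tx.1, smf gf.2 m tx)) _).
by move=> m p f tx /=; rewrite -smap_act /= -smap_act.
Defined.

Definition hcomp (X Y Z : sset) : smap (sprod (ihom Y Z) (ihom X Y)) (ihom X Z).
Proof.
refine (@SMap (sprod (ihom Y Z) (ihom X Y)) (ihom X Z) (@hcomp_simp X Y Z) _).
by move=> m n f gf; apply: smapP.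
Defined.

Section Hcomp.
Variables X Y Z : sset.

Lemma hcomp_name (g : smap Y Z) (f : smap X Y) :
  hcomp X Y Z 0 (name g, name f) = name (g \os f).
Proof. exact: smapP. Qed.

Lemma hcomp_degenl (g : smap Y Z) (e : ihom X Y 1) :
  hcomp X Y Z 1 (degen (name g), e) = postcomp X g 1 e.
Proof. exact: smapP. Qed.

Lemma hcomp_degenr (e : ihom Y Z 1) (f : smap X Y) :
  hcomp X Y Z 1 (e, degen (name f)) = precomp Z f 1 e.
Proof. by apply: smapP => n [t x]. Qed.

End Hcomp.

(** * Edges for the 2-cells B^nu x *)

Section PowEdge.
Variable B : sset.

Definition pow_edge (X : sset) (C D : category) (F G : functor C D)
    (nu : nattrans F G) (x : smap X (ihom (nerve D) B)) :
    ihom X (ihom (nerve C) B) 1 :=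
  precomp (ihom (nerve C) B) x 1 (powmap (nerve C) (nerve D) B 1 (nt_edge nu)).

Lemma pow_edge_chain (X : sset) (C D : category) (F G : functor C D)
    (nu : nattrans F G) (x : smap X (ihom (nerve D) B)) :
  chain (name (precomp B (nerve_map F) \os x)) [:: pow_edge nu x]
        (name (precomp B (nerve_map G) \os x)).
Proof.
by apply: conj; rewrite /pow_edge ?[chain _ _ _]/(etgt _ = _) ?esrc_map
  ?etgt_map ?nt_edge_src ?nt_edge_tgt powmap_name precomp_name.
Qed.

Lemma pow_edge_id (X : sset) (C D : category) (F : functor C D)
    (x : smap X (ihom (nerve D) B)) :
  pow_edge (nt_id F) x = degen (name (precomp B (nerve_map F) \os x)).
Proof.
by rewrite /pow_edge nt_edge_id -!degen_map powmap_name precomp_name.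
Qed.

Lemma pow_edge_eq (X : sset) (C D : category) (F G F' G' : functor C D)
    (nu : nattrans F G) (nu' : nattrans F' G') (x : smap X (ihom (nerve D) B)) :
  F = F' -> G = G' -> (forall c, heq (nu c) (nu' c)) ->
  pow_edge nu x = pow_edge nu' x.
Proof. by move=> eF eG h; rewrite /pow_edge (nt_edge_eq eF eG h). Qed.

(** An equation between natural transformations becomes a congruence of paths through the image of
    [nt_triangle]. The targets [H] and [K] are kept apart because functors such as
    [compf U (constf C a)] and [constf C (U a)] are not convertible. *)
Lemma pow_edge_comp (X : sset) (C D : category) (F G H K : functor C D)
    (mu : nattrans F G) (nu : nattrans G H) (rho : nattrans F K)
    (x : smap X (ihom (nerve D) B)) :
  H = K -> (forall c, heq (cmp (nu c) (mu c)) (rho c)) ->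
  path_cong (name (precomp B (nerve_map F) \os x))
    (name (precomp B (nerve_map K) \os x))
    [:: pow_edge mu x; pow_edge nu x] [:: pow_edge rho x].
Proof.
move=> eHK; case: _ / eHK rho => rho h.
have := @path_cong_tri _ (name (precomp B (nerve_map F) \os x))
  (name (precomp B (nerve_map H) \os x))
  (precomp _ x 2 (powmap _ _ B 2 (nt_triangle mu nu))).
rewrite !face_map face2_nt_triangle face0_nt_triangle face1_nt_triangle.
rewrite (@nt_edge_eq _ _ _ _ _ _ (nt_comp nu mu) rho) //; apply.
  by case: (pow_edge_chain mu x).
by case: (pow_edge_chain nu x).
Qed.

Lemma pow_edge_post (X : sset) (C D E : category) (U : functor D E)
    (F G : functor C D) (nu : nattrans F G) (x : smap X (ihom (nerve E) B)) :
  pow_edge nu (precomp B (nerve_map U) \os x) = pow_edge (nt_post U nu) x.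
Proof.
rewrite /pow_edge -nt_edge_post.
by apply: smapP => n [t a]; apply: smapP => m [s S] /=.
Qed.

Lemma precomp_comp (X : sset) (C D E : category) (U : functor D E)
    (F : functor C D) (x : smap X (ihom (nerve E) B)) :
  precomp B (nerve_map F) \os (precomp B (nerve_map U) \os x) =
  precomp B (nerve_map (compf U F)) \os x.
Proof.
apply: smapP => n a; apply: smapP => m [s S] /=; congr (x n a m (_, _)).
exact: functor_heqP.
Qed.

Lemma precomp_diag (X : sset) (C D : category) (F : functor C D)
    (b : smap X B) :
  precomp B (nerve_map F) \os (diag (nerve D) B \os b) =
  diag (nerve C) B \os b.
Proof. by apply: smapP => n x; apply: smapP. Qed.

(** A constant diagram ignores where it is evaluated, so every transformation acts on it
    trivially. *)
Lemma pow_edge_diag (X : sset) (C D : category) (F G : functor C D)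
    (nu : nattrans F G) (b : smap X B) :
  pow_edge nu (diag (nerve D) B \os b) = degen (name (diag (nerve C) B \os b)).
Proof. by apply: smapP => n [t a]; apply: smapP => m [s S]. Qed.

(** By [precomp_constf], [diag] after [eval] is restriction along the constant functor at [j], and
    the edge of a constant transformation is already constant in [C]. *)
Lemma diag_eval_pow_edge_const (X : sset) (C D : category) (j : C) (a b : D)
    (f : hom a b) (x : smap X (ihom (nerve D) B)) :
  postcomp X (diag (nerve C) B \os eval B (nerve_vtx C j)) 1
    (pow_edge (nt_const C f) x) = pow_edge (nt_const C f) x.
Proof.
rewrite -precomp_constf; apply: smapP => n [t y]; apply: smapP => m [s S] /=.
congr (x n y m (_, _)).
apply: functor_heqP => //= i i' h; move: (nt_le _ h).
by case: (0 < _)%N; case: (0 < _)%N.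
Qed.

Lemma eval_pow_edge (X : sset) (C D : category) (j : C) (F G : functor C D)
    (nu : nattrans F G) (x : smap X (ihom (nerve D) B)) :
  postcomp X (eval B (nerve_vtx C j)) 1 (pow_edge nu x) =
  postcomp X (eval B (nerve_vtx C j)) 1 (pow_edge (nt_const C (nu j)) x).
Proof.
apply: smapP => n [t y] /=; congr (x n y n (_, _)).
apply: functor_heqP => [i|i i' h] /=.
  by case: (0 < _)%N.
move: (nt_le _ h) => /=.
by case: (0 < t i)%N; case: (0 < t i')%N => //= _; rewrite fmap_id.
Qed.

(** Interchange of B^nu with the 2-cell represented by [s]. *)
Lemma pow_edge_natural (X : sset) (C D : category) (F G : functor C D)
    (nu : nattrans F G) (y z : smap X (ihom (nerve D) B)) s :
  chain (name y) s (name z) ->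
  path_cong (name (precomp B (nerve_map F) \os y))
    (name (precomp B (nerve_map G) \os z))
    (map (postcomp X (precomp B (nerve_map F)) 1) s ++ [:: pow_edge nu z])
    (pow_edge nu y :: map (postcomp X (precomp B (nerve_map G)) 1) s).
Proof.
move=> /(path_cong_natural (hcomp X _ _) (powmap _ _ B 1 (nt_edge nu))).
rewrite esrc_map etgt_map nt_edge_src nt_edge_tgt !powmap_name.
rewrite !hcomp_name !hcomp_degenr.
by rewrite !(eq_map (@hcomp_degenl _ _ _ _)).
Qed.

End PowEdge.

Definition idf (C : category) : functor C C :=
  @Functor C C id (fun _ _ => id) (fun _ => erefl) (fun _ _ _ _ _ => erefl).

(** * Absolute left liftings from split cones *)

Section SplitCone.
Variables (J D : category) (u : functor J D) (t : D) (ht : terminal t).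
Variables (j : J) (w : functor J J).
Variables (eps : nattrans w (idf J)) (p : nattrans w (constf J j)).
Variables (theta : nattrans u (compf u w)) (e : hom t (u j)).
Hypothesis eps_theta : forall i, cmp (fmap u (eps i)) (theta i) = idm (u i).
Hypothesis p_theta :
  forall i, cmp (fmap u (p i)) (theta i) = cmp e (bang ht (u i)).

(** * Uniqueness and existence of the factorization, on representing paths *)

Section Factorization.
Variables (B X : sset) (y : smap X (ihom (nerve D) B)) (b : smap X B).

Local Notation src := (name (precomp B (nerve_map u) \os y)).
Local Notation apex := (name (eval B (nerve_vtx D t) \os y)).
Local Notation cone := (pow_edge (to_terminal u ht) y).
Local Notation section := (pow_edge (nt_const J e) y).
Local Notation dg := (postcomp X (diag (nerve J) B)).
Local Notation ev := (postcomp X (eval B (nerve_vtx J j))).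

Lemma ev_name_const (a : D) :
  ev 0 (name (precomp B (nerve_map (constf J a)) \os y)) =
  name (eval B (nerve_vtx D a) \os y).
Proof.
apply: smapP => n [s x] /=; congr (y n x n (_, _)).
exact: functor_heqP.
Qed.

Lemma ev_src : ev 0 src = name (eval B (nerve_vtx D (u j)) \os y).
Proof.
rewrite -ev_name_const; apply: smapP => n [s x] /=; congr (y n x n (_, _)).
by apply: functor_heqP => //= i i' h; rewrite fmap_id.
Qed.

Lemma evK n (a : ihom X B n) : ev n (dg n a) = a.
Proof. by apply: smapP => m [s x] /=; apply: act_id. Qed.

(** This edge is B^e y : ev_t y => ev_j res y, the first factor of zeta. *)
Lemma ev_section_chain : chain apex [:: ev 1 section] (ev 0 src).
Proof.
have := chain_map ev (pow_edge_chain (nt_const J e) y).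
by rewrite ev_src !ev_name_const.
Qed.

(** The endomorphism t -> u j -> t is the identity because [t] is terminal. *)
Lemma ev_cone_section :
  path_cong apex apex [:: ev 1 section; ev 1 cone] [::].
Proof.
(* Under evaluation at [j] the cone may be replaced by the constant transformation at its component
   there, which is composable with [section] before evaluation. *)
rewrite (eval_pow_edge j (to_terminal u ht)) -ev_name_const.
set z := name (precomp _ _ \os _); have h : path_cong z z
    [:: section; pow_edge (nt_const J (bang ht (u j))) y]
    [:: pow_edge (nt_id (constf J t)) y].
  apply: pow_edge_comp => // i /=.
  by rewrite [cmp _ _](bang_uniq ht) -(bang_uniq ht (idm t)).
apply: path_cong_trans (path_cong_map ev h) _.
by rewrite pow_edge_id; apply: path_cong_map (path_cong_degen _).
Qed.

(** Evaluation at [j] undoes [dg], so the hypothesis becomes a congruence of ev r with [ev 1 cone]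
    followed by [s]; preceding both by [ev 1 section] cancels the cone. *)
Lemma cone_factor_unique s r :
  chain apex s (name b) ->
  path_cong src (name (diag (nerve J) B \os b)) r (cone :: map (dg 1) s) ->
  path_cong apex (name b) s (ev 1 section :: map (ev 1) r).
Proof.
have mapE : map (ev 1) (cone :: map (dg 1) s) = ev 1 cone :: s.
  by rewrite map_cons -map_comp (eq_map (@evK 1 : ev 1 \o dg 1 =1 id)) map_id.
move=> hs /(path_cong_map ev); rewrite mapE -(postcomp_name _ b) evK => h.
apply: path_cong_sym.
apply: path_cong_trans (path_cong_catl ev_section_chain h) _.
exact: path_cong_catr ev_cone_section hs.
Qed.

(** Naturality of B^q at [r], where the edge at the constant end is degenerate. The right-hand path
    does not depend on [q], which allows [eps] to be exchanged for [p]. *)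
Lemma natural_under_diag (G : functor J J) (q : nattrans w G) r :
  chain src r (name (diag (nerve J) B \os b)) ->
  path_cong (name (precomp B (nerve_map (compf u w)) \os y))
    (name (diag (nerve J) B \os b))
    (pow_edge (nt_post u q) y :: map (postcomp X (precomp B (nerve_map G)) 1) r)
    (map (postcomp X (precomp B (nerve_map w)) 1) r).
Proof.
move=> hr; have := pow_edge_natural q hr.
rewrite precomp_comp precomp_diag pow_edge_diag -pow_edge_post.
move=> h; apply: path_cong_trans (path_cong_sym h) _.
(* The empty path appended here is what the degenerate edge at the constant diagram reduces to. *)
rewrite -[X in path_cong _ _ _ X]cats0.
apply: path_cong_catl (path_cong_degen _).
have := chain_map (postcomp X (precomp B (nerve_map w))) hr.
by rewrite !postcomp_name precomp_comp precomp_diag.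
Qed.

Lemma eps_theta_cong :
  path_cong src src [:: pow_edge theta y; pow_edge (nt_post u eps) y] [::].
Proof.
have h : path_cong src src [:: pow_edge theta y; pow_edge (nt_post u eps) y]
    [:: pow_edge (nt_id u) y].
  apply: pow_edge_comp => [|i]; first exact: functor_heqP.
  by rewrite /= eps_theta.
by apply: path_cong_trans h _; rewrite pow_edge_id; apply: path_cong_degen.
Qed.

Lemma p_theta_cong :
  path_cong src (name (precomp B (nerve_map (constf J (u j))) \os y))
    [:: cone; section] [:: pow_edge theta y; pow_edge (nt_post u p) y].
Proof.
(* Both paths of length two contract to the single edge of the composite e . !. *)
have h : path_cong src (name (precomp B (nerve_map (constf J (u j))) \os y))
    [:: cone; section]
    [:: pow_edge (nt_comp (nt_const J e) (to_terminal u ht)) y].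
  exact: pow_edge_comp.
apply: path_cong_trans h (path_cong_sym _).
apply: pow_edge_comp => [|i]; first exact: compf_constf.
by rewrite /= p_theta.
Qed.

Lemma cone_factor_exists r :
  chain src r (name (diag (nerve J) B \os b)) ->
  path_cong src (name (diag (nerve J) B \os b)) r
    (cone :: map (dg 1) (ev 1 section :: map (ev 1) r)).
Proof.
move=> hr.
(* Here c ev_j is B^(const j) by [precomp_constf], and it fixes the constant edge [section]. *)
have mapE : map (dg 1) (ev 1 section :: map (ev 1) r) =
    section :: map (postcomp X (precomp B (nerve_map (constf J j))) 1) r.
  rewrite map_cons -map_comp precomp_constf; congr cons.
    by rewrite -[RHS](diag_eval_pow_edge_const j); apply: smapP.
  by apply: eq_map => a; apply: smapP.
have mapid : map (postcomp X (precomp B (nerve_map (idf J))) 1) r = r.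
  rewrite -[RHS]map_id; apply: eq_map => a.
  apply: smapP => n [s x]; apply: smapP => m [c S] /=.
  by congr (a n (s, x) m (_, _)); apply: functor_heqP.
rewrite mapE.
have hp := natural_under_diag p hr.
have he := natural_under_diag eps hr; rewrite mapid in he.
have hth := pow_edge_chain theta y.
(* Read from source to target, [r] becomes in turn theta, eps, r; then theta, B^w r; then theta, p,
   B^(const j) r; and finally cone, section, B^(const j) r. *)
apply: path_cong_trans (path_cong_sym (path_cong_catr eps_theta_cong hr)) _.
apply: path_cong_trans (path_cong_catl hth he) _.
apply: path_cong_trans (path_cong_catl hth (path_cong_sym hp)) _.
apply: path_cong_catr (path_cong_sym p_theta_cong) _.
have := chain_map (postcomp X (precomp B (nerve_map (constf J j)))) hr.
by rewrite !postcomp_name precomp_comp precomp_diag compf_constf.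
Qed.

End Factorization.

(** The condition says that [lam] becomes kappa y, for some [y], after restriction along any [x]. In
    this form it covers the canonical 2-cell, its component at a vertex and its image under a
    functor. *)
Lemma split_cone_lifting (B C : sset) (g : smap C (ihom (nerve J) B))
    (l : smap C B) (lam : cell g (diag (nerve J) B \os l)) :
  (forall (X : sset) (x : smap X C), exists y : smap X (ihom (nerve D) B),
    [/\ g \os x = precomp B (nerve_map u) \os y,
        l \os x = eval B (nerve_vtx D t) \os y
      & represents [:: pow_edge (to_terminal u ht) y] (whiskr lam x)]) ->
  abs_left_lifting (diag (nerve J) B) g l lam.
Proof.
move=> H X _ b x chi; have [y [gx lx hlam]] := H X x.
have [r hr] := representsP chi.
(* On representatives, the factorization equation for [zeta] is a congruence of paths free of
   transports. *)
have hzeta s (zeta : cell (l \os x) b) : represents s zeta ->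
    chi = cmp (whiskl (diag (nerve J) B) zeta)
      (cast_cell erefl (esym (compsA (diag (nerve J) B) l x))
        (whiskr lam x)) <->
    path_cong (name (precomp B (nerve_map u) \os y))
      (name (diag (nerve J) B \os b)) r
      (pow_edge (to_terminal u ht) y ::
       map (postcomp X (diag (nerve J) B) 1) s).
  move=> hs; rewrite -gx; apply: represents_eq => //.
  apply: (@represents_cmp _ _ _ _ [:: _]); first exact: represents_cast.
  exact: represents_cast (represents_map _ hs).
(* The path of zeta = ev_j chi . B^e y. *)
pose s := postcomp X (eval B (nerve_vtx J j)) 1 (pow_edge (nt_const J e) y) ::
  map (postcomp X (eval B (nerve_vtx J j)) 1) r.
have hr' := represents_chain hr; rewrite gx in hr'.
have hs : chain (name (l \os x)) s (name b).
  rewrite lx; apply: chain_cat (ev_section_chain y) _.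
  have := chain_map (postcomp X (eval B (nerve_vtx J j))) hr'.
  by rewrite -(postcomp_name _ b) evK.
have hrep : represents s (hclass (Epath hs)) := represents_class (Epath hs).
exists (hclass (Epath hs)); split.
  exact/(hzeta s _ hrep)/cone_factor_exists.
move=> zeta; have [s' hs'] := representsP zeta => /(hzeta s' zeta hs') h.
apply/(represents_eq hrep hs').
apply: path_cong_sym; rewrite lx; apply: cone_factor_unique h.
by rewrite -lx; apply: represents_chain hs'.
Qed.

End SplitCone.

(** * Representing paths of whiskerings and of [kappa] *)

Lemma represents_whiskr (X A B : sset) (f g : smap A B) (a : cell f g)
    (x : smap X A) s :
  represents s a -> represents (map (precomp B x 1) s) (whiskr a x).
Proof.
by move=> /(represents_map (precomp B x)) h; apply: represents_cast h.
Qed.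

Lemma represents_whiskl (X A B : sset) (k : smap A B) (f g : smap X A)
    (a : cell f g) s :
  represents s a -> represents (map (postcomp X k 1) s) (whiskl k a).
Proof.
by move=> /(represents_map (postcomp X k)) h; apply: represents_cast h.
Qed.

Lemma represents_cast_cell (A B : sset) (f f' g g' : smap A B) (ef : f = f')
    (eg : g = g') (a : cell f g) s :
  represents s a -> represents s (cast_cell ef eg a).
Proof. exact: represents_cast. Qed.

Lemma represents_kappa (J D : category) (u : functor J D) (t : D)
    (ht : terminal t) (B : sset) :
  represents [:: powmap (nerve J) (nerve D) B 1 (nt_edge (to_terminal u ht))]
    (kappa u ht B).
Proof.
have h :
    represents [:: nt_edge (to_terminal u ht)] (nt_cell (to_terminal u ht)).
  exact: represents_class (epath_edge _ _).
apply: represents_cast_cell; apply: represents_cast.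
exact: (represents_map (powmap _ _ B) h).
Qed.

(** * The split cone of [incl_DeltaInf] *)

(** The ordinal sum [0] + a: [unlift ord0] returns [None] exactly at the new least element, which is
    sent to the least element. *)
Definition ordhom_addbot m n (a : ordhom m n) : ordhom m.+1 n.+1.
Proof.
refine (@Ordhom m.+1 n.+1
  (fun i => oapp (fun i' => lift ord0 (a i')) ord0 (unlift ord0 i)) _) => i j.
case: unliftP => [i' ->|->] //=; case: unliftP => [j' ->|->] //=.
by rewrite /bump /= !add1n !ltnS; apply: ohP.
Defined.

Lemma ordhom_addbot0 m n (a : ordhom m n) : ordhom_addbot a ord0 = ord0.
Proof. by rewrite /= unlift_none. Qed.

Lemma ordhom_addbot_lift m n (a : ordhom m n) i :
  ordhom_addbot a (lift ord0 i) = lift ord0 (a i).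
Proof. by rewrite /= liftK. Qed.

Definition decalage : functor (opcat Delta) (opcat Delta).
Proof.
refine (@Functor (opcat Delta) (opcat Delta) succn
  (fun _ _ a => ordhom_addbot a) _ _).
- by move=> n; apply: ordhomP => i; case: (unliftP ord0 i) => [i' ->|->];
    rewrite ?ordhom_addbot0 ?ordhom_addbot_lift.
- move=> m n p b a; apply: ordhomP => i.
  case: (unliftP ord0 i) => [i' ->|->]; first by rewrite /= !liftK.
  by rewrite /= !unlift_none.
Defined.

Definition decalage_shift : nattrans decalage (idf (opcat Delta)).
Proof.
refine (@Nattrans (opcat Delta) (opcat Delta) decalage (idf _)
  (fun n => coface (ord0 : 'I_n.+2)) _).
by move=> m n a; apply: ordhomP => i; rewrite /= liftK.
Defined.

Definition decalage_bot :
  nattrans decalage (constf (opcat Delta) (0 : opcat Delta)).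
Proof.
refine (@Nattrans (opcat Delta) (opcat Delta) decalage (constf _ _)
  (fun n => ohcst 1 (ord0 : 'I_n.+2)) _).
by move=> m n a; apply: ordhomP => i; rewrite /= unlift_none.
Defined.

Lemma coface0_top n : coface (ord0 : 'I_n.+2) ord_max = ord_max.
Proof. exact: val_inj. Qed.

(** This map misses 0, unlike the maps in the image of [incl_split], which preserve 0. Its images
    under a splitting are the extra degeneracies. *)
Definition topface n : tophom n n.+1 := exist _ (coface ord0) (coface0_top n).

(** The new least element lies below every shifted threshold and adds one to the count; the other
    elements are shifted together with the threshold. *)
Lemma split_fun_ordhom_addbot m n (a : ordhom m n) (j : 'I_n.+1) :
  split_fun (ordhom_addbot a) (lift ord0 j) = lift ord0 (split_fun a j).
Proof.
apply: val_inj; rewrite /= -!sum1_card /bump add1n.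
rewrite big_mkcond big_ord_recl inE /= unlift_none /= add1n; congr (_.+1).
rewrite [RHS]big_mkcond; apply: eq_bigr => i _.
by rewrite !inE liftK.
Qed.

Definition incl_shift :
  nattrans incl_DeltaInf (compf incl_DeltaInf decalage).
Proof.
refine (@Nattrans (opcat Delta) DeltaInf incl_DeltaInf
  (compf incl_DeltaInf decalage) (fun n => topface n.+1) _).
by move=> m n a; apply: tophomP => j; rewrite /= split_fun_ordhom_addbot.
Defined.

(** The composite sends j to the number of i in [n] with i + 1 < j + 1, which is j. *)
Lemma shift_incl_shift (n : opcat Delta) :
  cmp (fmap incl_DeltaInf (decalage_shift n)) (incl_shift n) =
  idm (incl_DeltaInf n).
Proof.
apply: tophomP => j; apply: val_inj; have jn : (j <= n.+1)%N by rewrite -ltnS.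
apply: etrans (card_ltn_ord jn); apply: eq_card => i.
by rewrite !inE.
Qed.

(** Both sides are constant at 1: the single element of [0] goes to 0, below every threshold j +
    1. *)
Lemma bot_incl_shift (n : opcat Delta) :
  cmp (fmap incl_DeltaInf (decalage_bot n)) (incl_shift n) =
  cmp (topface 0 : @hom DeltaInf 0 1) (bang terminal_Delta0 (incl_DeltaInf n)).
Proof.
apply: tophomP => j; apply: val_inj => /=.
by rewrite (@eq_card _ _ predT) ?card_ord // => i; rewrite !inE.
Qed.

Lemma split_simplicial_lifting (B C : sset) (g : smap C (ihom NDop B))
    (l : smap C B) (lam : cell g (diag NDop B \os l)) :
  (forall (X : sset) (x : smap X C), exists y : smap X (ihom NDinf B),
    [/\ g \os x = res B \os y, l \os x = ev0 B \os y
      & represents [:: pow_edge (to_terminal incl_DeltaInf terminal_Delta0) y]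
          (whiskr lam x)]) ->
  abs_left_lifting (diag NDop B) g l lam.
Proof. exact: (split_cone_lifting shift_incl_shift bot_incl_shift). Qed.

(** [incl_split] sends the empty ordinal to the terminal [0], so uniqueness of maps to [0]
    identifies the cone of the augmentation with the canonical one. *)
Lemma incl_split_cone (B X : sset) (y : smap X (ihom NDinf B)) :
  pow_edge (to_terminal incl_Delta terminal_empty)
    (precomp B (nerve_map incl_split) \os y) =
  pow_edge (to_terminal incl_DeltaInf terminal_Delta0) y.
Proof.
rewrite pow_edge_post; apply: pow_edge_eq => // [|n].
  exact: compf_constf.
exact: eq_heq (bang_uniq terminal_Delta0 _).
Qed.

Theorem theorem5p3p1 (B : sset) (hB : quasi_category B) :
  abs_left_lifting (diag NDop B) (res B) (ev0 B) (kappa_split B)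
  /\ (forall (d : smap NDop B)
        (X : smap NDplus B)
        (D : smap NDinf B)
        (hX : X \os nerve_map incl_Delta = d)
        (hD : D \os nerve_map incl_split = X),
      colimit_cone d (D 0 (nerve_vtx DeltaInf 0))
        (cast_cell erefl (split_apex hD) (aug_cone hX)))
  /\ (forall (A : sset) (hA : quasi_category A) (k : smap B A),
      abs_left_lifting (diag NDop A) (postcomp NDop k \os res B)
        (k \os ev0 B)
        (cast_cell erefl (postcomp_diag k)
           (whiskl (postcomp NDop k) (kappa_split B)))).
Proof.
have hk := represents_kappa incl_DeltaInf terminal_Delta0 B.
split; last split.
- apply: split_simplicial_lifting => X x; exists x; split=> //.
  exact: (represents_whiskr x hk).
- move=> d X D hX hD; apply: split_simplicial_lifting => Y x.
  (* The family [y] is constant at the vertex [D] of B^Delta_infty. *)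
  exists (yoneda (name D) \os x); split.
  + rewrite -hX -hD; apply: smapP => n a; apply: smapP => m [s S] /=.
    by congr (D m _); apply: functor_heqP.
  + apply: smapP => n a; rewrite /= -smap_act; congr (D n _).
    exact: functor_heqP.
  + rewrite -incl_split_cone compsA precomp_yoneda hD.
    rewrite (_ : pow_edge _ _ = precomp (ihom NDop B) x 1
      (pow_edge (to_terminal incl_Delta terminal_empty) (yoneda (name X))));
      last by apply: smapP => n [a s].
    apply: (@represents_whiskr _ _ _ _ _ _ _ [:: _]).
    (* The transports come from [split_apex], [aug_cone] and [terminal_cone]. *)
    do 3 apply: represents_cast_cell.
    apply: (@represents_whiskr _ _ _ _ _ _ _ [:: _]); exact: represents_kappa.
- move=> A _ k; apply: split_simplicial_lifting => X x.
  exists (postcomp NDinf k \os x); split.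
  + by apply: smapP => n a; apply: smapP => m [s S].
  + by apply: smapP.
  (* Natural transformations act by precomposition, hence commute with postcomposition by [k]. *)
  + rewrite (_ : pow_edge _ _ = precomp (ihom NDop A) x 1
      (postcomp (ihom NDinf B) (postcomp NDop k) 1 (powmap NDop NDinf B 1
        (nt_edge (to_terminal incl_DeltaInf terminal_Delta0)))));
      last by apply: smapP => n [a s]; apply: smapP => m [c S] /=.
    apply: (@represents_whiskr _ _ _ _ _ _ _ [:: _]).
    apply: represents_cast_cell.
    apply: (@represents_whiskl _ _ _ _ _ _ _ [:: _]).
    exact: hk.
Qed.
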